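(* For every finite simple digraph $H$ there exists a constant $c_H$ (depending only on $H$) such that for every positive integer $k$ and every tournament $T$, at least one of the following holds: (i) $T$ contains $k$ pairwise arc-disjoint immersion copies of $H$; or (ii) there exists a set of at most $c_H\cdot k^3$ arcs of $T$ that intersects (the arc set of) every immersion copy of $H$ in $T$. In other words, $H$ has the Erdős–Pósa property for immersions in tournaments with a bounding function $f(k)\in\mathcal{O}_H(k^3)$.
   Context: All digraphs are finite and simple (no loops, no two arcs with the same head and tail). A tournament is a simple digraph in which every pair of distinct vertices is joined by exactly one arc. A digraph $\widehat H$ is an immersion copy (immersion model) of a digraph $H$ if there is a map $\phi$ sending vertices of $H$ to pairwise distinct vertices of $\widehat H$ and each arc $(u,v)$ of $H$ to a directed path in $\widehat H$ from $\phi(u)$ to $\phi(v)$, such that every arc of $\widehat H$ lies on exactly one of these paths (so the paths are pairwise arc-disjoint). An immersion copy of $H$ in $T$ means a subgraph of $T$ that is an immersion copy of $H$. *)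

(* Defs.v *)
From mathcomp Require Import all_boot.
Set Implicit Arguments. Unset Strict Implicit. Unset Printing Implicit Defensive.

(* A finite simple digraph: a finite vertex type V with an irreflexive arc
   relation e (e x y means there is an arc (x,y)); since e is a relation,
   there are no two arcs with the same tail and head. *)
Definition simple_digraph (V : finType) (e : rel V) : Prop :=
  forall x, ~~ e x x.

Definition tournament (V : finType) (e : rel V) : Prop :=
  simple_digraph e /\ forall x y, x != y -> e x y != e y x.

Definition arcs (V : finType) (e : rel V) : {set V * V} :=
  [set a | e a.1 a.2].

(* A directed path is represented by its start x and the list s of the
   remaining vertices; it visits x :: s.  Its arc set: *)
Definition path_arcs (V : finType) (x : V) (s : seq V) : {set V * V} :=
  [set a in zip (x :: s) s].

Definition dipath (V : finType) (e : rel V) (x y : V) (s : seq V) : Prop :=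
  [/\ path e x s, last x s = y & uniq (x :: s)].

Definition immersion_copy (VH VT : finType) (eH : rel VH) (eT : rel VT)
    (A : {set VT * VT}) : Prop :=
  exists (phi : VH -> VT) (P : VH -> VH -> seq VT),
    [/\ injective phi,
        (forall u v, eH u v -> dipath eT (phi u) (phi v) (P u v)),
        (forall u v u' v', eH u v -> eH u' v' -> (u, v) != (u', v') ->
            [disjoint path_arcs (phi u) (P u v) & path_arcs (phi u') (P u' v')])
      & A = \bigcup_(a | eH a.1 a.2) path_arcs (phi a.1) (P a.1 a.2)].

(* Main.v *)
(* Order a tournament by non-increasing outdegree and let t = O(k).
   - If a vertex y has many back arcs into a prefix X, then y reaches each x in X with many
     in-neighbours among these heads by many 2-paths, and x reaches y by many 2-paths since
     d(y) <= d(x): all these x are pairwise joined by short paths that survive the deletion of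
     fewer than t arcs.
   - If back degrees are O(k) but some cut has many back arcs, take a matching (y_j, x_j) of back
     arcs; paths x -> y_j -> x_j -> x' again join many vertices robustly.
   Routing greedily between |V(H)| such vertices gives k copies of H. Otherwise every cut has O(k^2)
   back arcs and every vertex is in O(k) of them, so that two vertices separated by O(k)
   consecutive ones are robustly joined in the forward direction.
   Now induct on V(H). A copy that avoids the hitting sets F0 of proper parts of H, relative to
   prefixes and suffixes, cannot be split by an interval of O(k) vertices (a zone) over which
   there is no back arc: otherwise k copies of the left part and k copies of the right part could
   be linked through the zone. Hence a greedy search works: take a shortest prefix that
   contains a copy, delete the O(k^2) back arcs over and the arcs inside the zone around its end,
   and continue to the right of it, at most k times. *)
Require Import Defs.
From mathcomp Require Import all_boot zify.
From Stdlib Require Import Classical.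

Set Implicit Arguments. Unset Strict Implicit. Unset Printing Implicit Defensive.

(** * Robust reachability and greedy routing *)

Section Walks.
Variable V : finType.
Implicit Types (e r : rel V) (F : {set V * V}) (W : {set V}) (x y u v : V).

Definition off F e : rel V := fun x y => e x y && ((x, y) \notin F).
Definition rst W e : rel V := fun x y => [&& x \in W, y \in W & e x y].

Lemma path_arcs_rel r x s a : path r x s -> a \in path_arcs x s -> r a.1 a.2.
Proof.
rewrite /path_arcs inE; elim: s x => [//|y s IH] x /= /andP[rxy rs].
by rewrite inE => /orP[/eqP->//|]; apply: IH.
Qed.

Lemma path_arcs_disjoint r r' x s y q :
  path r x s -> path r' y q -> (forall a b, r a b -> r' a b -> False) ->
  [disjoint path_arcs x s & path_arcs y q].
Proof.
move=> rs rq no; apply/pred0P=> a /=; apply/negbTE/negP => /andP[a1 a2].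
exact: no (path_arcs_rel rs a1) (path_arcs_rel rq a2).
Qed.

Lemma card_path_arcs x s : #|path_arcs x s| <= size s.
Proof.
by rewrite /path_arcs cardsE (leq_trans (card_size _)) // size_zip /= geq_minr.
Qed.

Lemma path_off F r x s :
  path r x s -> F :&: path_arcs x s = set0 -> path (off F r) x s.
Proof.
move=> rs /setP dF; have {}dF a : a \in path_arcs x s -> a \notin F.
  by move=> aP; have := dF a; rewrite in_setI in_set0 aP andbT => ->.
elim: s x rs dF => [//|y s IH] x /= /andP[rxy rs] dF.
rewrite {1}/off rxy dF ?inE ?eqxx //=.
by apply: IH => // a aP; apply: dF; move: aP; rewrite !inE => ->; rewrite orbT.
Qed.

Lemma path_rst W r x s :
  path r x s -> (forall z, z \in x :: s -> z \in W) -> path (rst W r) x s.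
Proof.
elim: s x => [//|y s IH] x /= /andP[rxy rs] inW.
rewrite {1}/rst rxy !inW ?inE ?eqxx ?orbT //=.
by apply: IH => // z zs; apply: inW; rewrite inE zs orbT.
Qed.

(** The length bound [L] makes greedy routing possible: each routed path consumes at most [L] arcs.
    Walks are allowed here and shortened to simple paths in [route]. *)
Definition robust t L r u v := forall F, #|F| < t ->
  exists s, [/\ path (off F r) u s, last u s = v & size s <= L].

Lemma robust_trans t L L' r u v w :
  robust t L r u v -> robust t L' r v w -> robust t (L + L') r u w.
Proof.
move=> h h' F Ft; have [s [ps ls zs]] := h F Ft; have [q [pq lq zq]] := h' F Ft.
exists (s ++ q); rewrite cat_path last_cat ps ls pq lq size_cat; split=> //.
exact: leq_add.
Qed.

Lemma robust_leq t L L' r u v : L <= L' -> robust t L r u v -> robust t L' r u v.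
Proof.
by move=> LL h F /h[s [? ? zs]]; exists s; split=> //; apply: leq_trans LL.
Qed.

Definition touched F : {set V} := (fst @: F) :|: (snd @: F).

Lemma card_touched F : #|touched F| <= 2 * #|F|.
Proof.
rewrite (leq_trans (leq_card_setU _ _)) // mul2n -addnn.
by apply: leq_add; apply: leq_imset_card.
Qed.

Lemma untouchedl F x y : x \notin touched F -> (x, y) \notin F.
Proof.
by apply: contra => h; rewrite inE; apply/orP; left; apply/imsetP; exists (x, y).
Qed.

Lemma untouchedr F x y : y \notin touched F -> (x, y) \notin F.
Proof.
by apply: contra => h; rewrite inE; apply/orP; right; apply/imsetP; exists (x, y).
Qed.

(** Fewer than [t] arcs touch fewer than [2 * t] vertices, so some midpoint in [S] escapes. *)
Lemma robust2 t r u v (S : {set V}) :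
  2 * t <= #|S| -> (forall z, z \in S -> r u z && r z v) -> robust t 2 r u v.
Proof.
move=> cS rS F Ft; have [z zS zF] : exists2 z, z \in S & z \notin touched F.
  apply/subsetPn/negP => /subset_leq_card.
  by have := card_touched F; lia.
exists [:: z; v]; have /andP[h1 h2] := rS z zS.
by rewrite /= /off h1 h2 (untouchedl _ zF) (untouchedr _ zF).
Qed.

(* Route the demands one at a time, avoiding the at most [L] arcs used by each previous one. *)
Lemma route (J : eqType) (src tgt : J -> V) r t L (js : seq J) :
  L * size js < t -> (forall j, j \in js -> robust t L r (src j) (tgt j)) ->
  exists P : J -> seq V,
    (forall j, j \in js -> dipath r (src j) (tgt j) (P j)) /\
    (forall j j', j \in js -> j' \in js -> j != j' ->
      [disjoint path_arcs (src j) (P j) & path_arcs (src j') (P j')]).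
Proof.
move=> szt rob.
(* [F] accumulates the arcs used so far; robustness is then applied against it. *)
suff [P [F [dP [sF [cF dis]]]]] : exists P : J -> seq V, exists F : {set V * V},
    (forall j, j \in js -> dipath r (src j) (tgt j) (P j)) /\
    ((forall j, j \in js -> path_arcs (src j) (P j) \subset F) /\
    (#|F| <= L * size js /\
    (forall j j', j \in js -> j' \in js -> j != j' ->
      [disjoint path_arcs (src j) (P j) & path_arcs (src j') (P j')]))).
  by exists P.
elim: js szt rob => [|j js IH] szt rob.
  by exists (fun=> [::]), set0; rewrite cards0.
have [||P [F [dP [sF [cF dis]]]]] := IH.
- by move: szt => /=; lia.
- by move=> i ijs; apply: rob; rewrite inE ijs orbT.
have [jjs|jjs] := boolP (j \in js).
  exists P, F; have E i : (i \in j :: js) = (i \in js).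
    by rewrite inE; case: eqP => // ->.
  split=> [i|]; first by rewrite E; apply: dP.
  split=> [i|]; first by rewrite E; apply: sF.
  by split=> [|i i']; [rewrite /= mulnS; apply: leq_trans cF _; apply: leq_addl | rewrite !E; apply: dis].
have [|s [ps ls zs]] := rob j (mem_head _ _) F; first by apply: leq_ltn_trans cF _; move: szt => /=; lia.
case/shortenP: ps ls => q pq uq sq lq.
have zq : size q <= L.
  by apply: leq_trans zs; apply: uniq_leq_size => //; case/andP: uq.
have new i : i \in js -> [disjoint path_arcs (src j) q & path_arcs (src i) (P i)].
  move=> ijs; apply/pred0P=> a /=; apply/negbTE/negP => /andP[a1 a2].
  have /andP[_] := path_arcs_rel pq a1.
  by case: a a1 a2 => a b a1 a2 /=; rewrite (subsetP (sF i ijs)).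
have ne i : i \in js -> (i == j) = false by move=> h; apply: contraNF jjs => /eqP<-.
exists (fun i => if i == j then q else P i), (F :|: path_arcs (src j) q).
split=> [i|].
  rewrite inE; have [-> _|_ /=] := eqVneq i j; last exact: dP.
  split=> //; apply: sub_path pq => a b; by case/andP.
split=> [i|].
  rewrite inE; have [-> _|_ /= ijs] := eqVneq i j; first exact: subsetUr.
  by apply: subset_trans (sF i ijs) _; apply: subsetUl.
split.
  rewrite (leq_trans (leq_card_setU _ _)) //= mulnS addnC leq_add //.
  exact: leq_trans (card_path_arcs _ _) zq.
move=> i i'; rewrite !in_cons; have [->|nij] := eqVneq i j; have [->|nij'] := eqVneq i' j => //=.
- by move=> _ h _; apply: new.
- by move=> h _ _; rewrite disjoint_sym; apply: new.
- by move=> h h' ii; apply: dis.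
Qed.

End Walks.

(** * Robustly connected sets from back arcs *)

Section Tournaments.
Variables (V : finType).
Implicit Types (e : rel V) (W N X Y : {set V}).

(* The arcs of [e] are confined to [W], so that subtournaments need no change of type. *)
Definition tour W e : Prop :=
  [/\ forall x, ~~ e x x, forall x y, e x y -> (x \in W) && (y \in W)
    & forall x y, x \in W -> y \in W -> x != y -> e x y = ~~ e y x].

Lemma tour_rst W W' e : W' \subset W -> tour W e -> tour W' (rst W' e).
Proof.
move=> /subsetP sW [ir inW tot]; split=> [x|x y /and3P[-> ->]//|x y xW yW xy].
  by rewrite /rst (negbTE (ir x)) !andbF.
by rewrite /rst xW yW /= tot ?sW.
Qed.

Lemma tour_asym W e x y : tour W e -> e x y -> ~~ e y x.
Proof.
move=> [ir inW tot] exy; have /andP[xW yW] := inW _ _ exy.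
have [xy|xy] := eqVneq x y; first by move: exy; rewrite xy (negbTE (ir y)).
by rewrite -tot.
Qed.

Lemma tour_total W e x y : tour W e -> x \in W -> y \in W -> x != y -> ~~ e x y -> e y x.
Proof. by move=> [ir inW tot] xW yW xy; rewrite tot // negbK. Qed.

(** Double counting of the ordered pairs in [N]: with [n = #|N|], [n ^ 2 <= 2 * n * s + n]. *)
Lemma indeg_bound W e N s : tour W e -> N \subset W ->
  (forall x, x \in N -> #|[set y in N | e y x]| <= s) -> #|N| <= 2 * s + 1.
Proof.
move=> [ir inW tot] /subsetP sN deg.
have sumE : \sum_(x in N) \sum_(y in N) (e x y + e y x + (x == y)) = #|N| * #|N|.
  rewrite -sum_nat_const; apply: eq_bigr => x xN; rewrite -sum1_card.
  apply: eq_bigr => y yN; have [->|xy] := eqVneq x y; first by rewrite (negbTE (ir y)).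
  by rewrite tot ?sN //; case: (e y x).
have le1 : \sum_(x in N) \sum_(y in N) e y x <= #|N| * s.
  rewrite -sum_nat_const; apply: leq_sum => x xN.
  apply: leq_trans (deg x xN); rewrite -sum1_card big_mkcond [leqRHS]big_mkcond /=.
  by apply: leq_sum => y _; rewrite inE; case: (y \in N); case: (e y x).
have le3 : \sum_(x in N) \sum_(y in N) (x == y) = #|N|.
  rewrite -sum1_card; apply: eq_bigr => x xN.
  by rewrite (bigD1 x) //= eqxx big1 ?addn0 // => y /andP[_]; rewrite eq_sym => /negbTE->.
have le2 : \sum_(x in N) \sum_(y in N) e x y <= #|N| * s by rewrite exchange_big.
move: sumE; under eq_bigr do rewrite !big_split /=.
rewrite !big_split /= le3; nia.
Qed.

Lemma rev_tour W e : tour W e -> tour W (fun x y => e y x).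
Proof.
move=> [ir inW tot]; split=> // [x y /inW|x y xW yW xy]; first by rewrite andbC.
by apply: tot; rewrite // eq_sym.
Qed.

(** The vertices of [N] outside the counted set have in-degree at most [s] even among themselves, so
    [indeg_bound] allows at most [2 * s + 1] of them. *)
Lemma many_indeg W e N s p : tour W e -> N \subset W -> 2 * s + p + 1 <= #|N| ->
  p <= #|[set x in N | s < #|[set y in N | e y x]|]|.
Proof.
move=> te sN cN; set S := [set x in N | _].
have := cardsID S N; rewrite (setIidPr _); last by apply/subsetP=> x; rewrite inE => /andP[].
suff : #|N :\: S| <= 2 * s + 1 by lia.
apply: indeg_bound te _ _ => [|x].
  by apply: subset_trans sN; apply: subsetDl.
rewrite !inE negb_and -leqNgt => /andP[/orP[/negbTE->//|h] xN].
apply: leq_trans h; apply: subset_leq_card; apply/subsetP=> y.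
by rewrite !inE => /andP[/andP[_ ->]].
Qed.

Definition outdeg e x := #|[set y | e x y]|.

(** By the out-degree comparison, at least as many vertices are dominated by [x] only as by [y]
    only, and each of the former is the midpoint of a path from [x] to [y]. *)
Lemma robust_back W e t x y : tour W e -> e y x -> outdeg e y <= outdeg e x ->
  2 * t <= #|[set z | e y z && ~~ e x z]| -> robust t 2 e x y.
Proof.
move=> te eyx dxy ct; apply: (@robust2 _ _ _ _ _ [set z | e x z && ~~ e y z]).
  apply: leq_trans ct _.
  have E a b : [set z | e a z && ~~ e b z] = [set z | e a z] :\: [set z | e b z].
    by apply/setP=> z; rewrite !inE andbC.
  have := cardsID [set z | e y z] [set z | e x z].
  have := cardsID [set z | e x z] [set z | e y z].
  rewrite -!E setIC; move: dxy; rewrite /outdeg; lia.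
move=> z; rewrite inE => /andP[exz nyz]; rewrite exz /=; have [ir inW tot] := te.
have /andP[yW _] := inW _ _ eyx; have /andP[_ zW] := inW _ _ exz.
apply: (tour_total te) => //; apply: contraTneq exz => <-.
exact: tour_asym te eyx.
Qed.

(** The vertex [y] is a hub. [S] collects the heads with more than [2 * t] in-neighbours among the
    heads. The in-neighbours of [v] give 2-paths from [y] to [v]; those of [u] are dominated by [y]
    but not by [u], so [robust_back] leads from [u] to [y]. *)
Lemma star_out W e t p X y : tour W e -> X \subset W -> 
  (forall x, x \in X -> outdeg e y <= outdeg e x) ->
  4 * t + p + 1 <= #|[set x in X | e y x]| ->
  exists S : {set V}, [/\ S \subset W, p <= #|S|
    & forall u v, u \in S -> v \in S -> robust t 4 e u v].
Proof.
move=> te sX dX cN; set N := [set x in X | e y x] in cN.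
have sN : N \subset W.
  by apply: subset_trans sX; apply/subsetP=> x; rewrite inE => /andP[].
exists [set x in N | 2 * t < #|[set y in N | e y x]|]; split.
- by apply/subsetP=> x; rewrite inE => /andP[/(subsetP sN)].
- by apply: many_indeg te sN _; lia.
move=> u v; rewrite !inE => /andP[/andP[uX eyu] du] /andP[/andP[vX eyv] dv].
apply: (@robust_trans _ _ 2 2 _ _ y).
  apply: (robust_back te eyu (dX _ uX)); apply: leq_trans (ltnW du) _.
  apply: subset_leq_card; apply/subsetP=> z; rewrite !inE => /andP[/andP[_ ->] ezu] /=.
  exact: tour_asym te ezu.
apply: (@robust2 _ _ _ _ _ [set x in N | e x v]); first exact: ltnW.
by move=> z; rewrite !inE => /andP[/andP[_ ->] ->].
Qed.

(** Mirror image of [star_out] with hub [x]; vertices of large out-degree are counted in the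
    reversed tournament. *)
Lemma star_in W e t p Y x : tour W e -> Y \subset W ->
  (forall y, y \in Y -> outdeg e y <= outdeg e x) ->
  4 * t + p + 1 <= #|[set y in Y | e y x]| ->
  exists S : {set V}, [/\ S \subset W, p <= #|S|
    & forall u v, u \in S -> v \in S -> robust t 4 e u v].
Proof.
move=> te sY dY cN; set N := [set y in Y | e y x] in cN.
have sN : N \subset W.
  by apply: subset_trans sY; apply/subsetP=> y; rewrite inE => /andP[].
exists [set y in N | 2 * t < #|[set z in N | e y z]|]; split.
- by apply/subsetP=> y; rewrite inE => /andP[/(subsetP sN)].
- by apply: many_indeg (rev_tour te) sN _; lia.
move=> u v; rewrite !inE => /andP[/andP[uY eux] du] /andP[/andP[vY evx] dv].
apply: (@robust_trans _ _ 2 2 _ _ x).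
  apply: (@robust2 _ _ _ _ _ [set z in N | e u z]); first exact: ltnW.
  by move=> z; rewrite !inE => /andP[/andP[_ ->] ->].
apply: (robust_back te evx (dY _ vY)); apply: leq_trans (ltnW dv) _.
apply: subset_leq_card; apply/subsetP=> z; rewrite !inE => /andP[/andP[_ ezx] ->] /=.
exact: tour_asym te ezx.
Qed.

(** Greedy choice: by the degree bounds, each chosen arc excludes at most [2 * D] arcs of [B],
    itself included. *)
Lemma matching_exists (B : {set V * V}) D m :
  (forall y, #|[set x | (y, x) \in B]| <= D) -> (forall x, #|[set y | (y, x) \in B]| <= D) ->
  2 * D * m < #|B| ->
  exists M : {set V * V}, [/\ M \subset B, #|M| = m.+1,
    {in M &, injective fst} & {in M &, injective snd}].
Proof.
move=> d1 d2; elim: m => [|m IH] cB.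
  have /set0Pn[a aB] : B != set0 by rewrite -card_gt0; lia.
  exists [set a]; rewrite sub1set cards1; split=> //.
    by move=> b c; rewrite !inE => /eqP-> /eqP->.
  by move=> b c; rewrite !inE => /eqP-> /eqP->.
have [|M [sM cM i1 i2]] := IH; first by move: cB; lia.
pose C := \bigcup_(a in M) ([set b in B | b.1 == a.1] :|: [set b in B | b.2 == a.2]).
have cC : #|C| <= #|M| * (2 * D).
  rewrite /C -sum_nat_const; elim/big_rec2: _ => [|a n S aM h]; first by rewrite cards0.
  rewrite (leq_trans (leq_card_setU _ _)) // leq_add //.
  rewrite (leq_trans (leq_card_setU _ _)) // mul2n -addnn leq_add //.
    apply: leq_trans (d1 a.1).
    rewrite -(@card_in_imset _ _ snd [set b in B | b.1 == a.1]).
      by apply: subset_leq_card; apply/subsetP=> _ /imsetP[[b c]] /[!inE]/= /andP[bB /eqP<- ->].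
    by move=> [b c] [b' c'] /[!inE]/= /andP[_ /eqP->] /andP[_ /eqP->] ->.
  apply: leq_trans (d2 a.2).
  rewrite -(@card_in_imset _ _ fst [set b in B | b.2 == a.2]).
    by apply: subset_leq_card; apply/subsetP=> _ /imsetP[[b c]] /[!inE]/= /andP[bB /eqP<- ->].
  by move=> [b c] [b' c'] /[!inE]/= /andP[_ /eqP->] /andP[_ /eqP->] ->.
have [b bB bC] : exists2 b, b \in B & b \notin C.
  apply/subsetPn/negP => /subset_leq_card; move: cB cC; rewrite cM; lia.
have nb a : a \in M -> (b.1 == a.1) = false /\ (b.2 == a.2) = false.
  move=> aM; have : b \notin ([set b in B | b.1 == a.1] :|: [set b in B | b.2 == a.2]).
    by apply: contra bC => h; apply/bigcupP; exists a.
  by rewrite !inE bB /= negb_or => /andP[/negbTE-> /negbTE->].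
exists (b |: M); split.
- by rewrite subUset sub1set bB.
- rewrite cardsU1 cM; suff -> : b \notin M by [].
  by apply/negP => /nb[]; rewrite eqxx.
- move=> a a' /setU1P[->|aM] /setU1P[->|a'M] // h; last exact: i1.
    by have [] := nb _ a'M; rewrite h eqxx.
  by have [] := nb _ aM; rewrite h eqxx.
- move=> a a' /setU1P[->|aM] /setU1P[->|a'M] // h; last exact: i2.
    by have [] := nb _ a'M; rewrite h eqxx.
  by have [] := nb _ aM; rewrite h eqxx.
Qed.

(** For a prefix [X] of an ordering, these are the back arcs over the cut at its end. *)
Definition back e X : {set V * V} := [set a | [&& e a.1 a.2, a.1 \notin X & a.2 \in X]].

(** Links have the form [u -> y -> x -> v] with [(y, x)] in [M]. The choice of [S] gives more than
    [D + 4 * t] arcs of [M] whose head dominates [v]; at most [D] are lost because [y] dominates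
    [u], and at most [4 * #|F|] because [F] touches an end. *)
Lemma matching_robust W e t p D X (M : {set V * V}) : tour W e -> X \subset W ->
  (forall x, x \in X -> #|[set y | e y x & y \notin X]| <= D) ->
  M \subset back e X -> {in M &, injective fst} -> {in M &, injective snd} ->
  2 * (D + 4 * t) + p + 1 <= #|M| ->
  exists S : {set V}, [/\ S \subset W, p <= #|S|
    & forall u v, u \in S -> v \in S -> robust t 4 e u v].
Proof.
move=> te /subsetP sX dX /subsetP sM i1 i2 cM; have [ir inW tot] := te.
have cX : #|snd @: M| = #|M| by apply: card_in_imset.
have X0X x : x \in snd @: M -> x \in X by case/imsetP=> a /sM; rewrite inE => /and3P[_ _ ?] ->.
have sX0 : snd @: M \subset W by apply/subsetP=> x /X0X/sX.
exists [set x in snd @: M | D + 4 * t < #|[set y in snd @: M | e y x]|]; split.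
- by apply/subsetP=> x; rewrite inE => /andP[/(subsetP sX0)].
- by apply: many_indeg te sX0 _; lia.
move=> u v; rewrite !inE => /andP[/X0X uX _] /andP[/X0X vX dv].
apply: (@robust_leq _ _ 3) => // F Ft.
move: (touched F) (card_touched F) (@untouchedl _ F) (@untouchedr _ F) => T cT uL uR.
pose Mv := [set a in M | e a.2 v].
have cMv : D + 4 * t < #|Mv|.
  apply: leq_trans dv _; rewrite -(@card_in_imset _ _ snd Mv).
    apply: subset_leq_card; apply/subsetP=> x /[!inE]/andP[/imsetP[a aM ->] h].
    by apply/imsetP; exists a; rewrite // inE aM.
  by move=> a b; rewrite !inE => /andP[aM _] /andP[bM _]; apply: i2.
pose B1 := [set a in M | e a.1 u].
have cB1 : #|B1| <= D.
  apply: leq_trans (dX u uX); rewrite -(@card_in_imset _ _ fst B1).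
    apply: subset_leq_card; apply/subsetP=> x /imsetP[a /[!inE]/andP[/sM aM h] ->].
    by move: aM; rewrite !inE h => /and3P[].
  by move=> a b; rewrite !inE => /andP[aM _] /andP[bM _]; apply: i1.
pose B2 := [set a in M | a.1 \in T].
have cB2 : #|B2| <= 2 * #|F|.
  apply: leq_trans cT; rewrite -(@card_in_imset _ _ fst B2).
    by apply: subset_leq_card; apply/subsetP=> x /imsetP[a /[!inE]/andP[_ ?] ->].
  by move=> a b; rewrite !inE => /andP[aM _] /andP[bM _]; apply: i1.
pose B3 := [set a in M | a.2 \in T].
have cB3 : #|B3| <= 2 * #|F|.
  apply: leq_trans cT; rewrite -(@card_in_imset _ _ snd B3).
    by apply: subset_leq_card; apply/subsetP=> x /imsetP[a /[!inE]/andP[_ ?] ->].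
  by move=> a b; rewrite !inE => /andP[aM _] /andP[bM _]; apply: i2.
have [[y x] aMv] : exists2 a, a \in Mv & a \notin B1 :|: B2 :|: B3.
  apply/subsetPn/negP => /subset_leq_card.
  have := (leq_card_setU (B1 :|: B2) B3).1; have := (leq_card_setU B1 B2).1; lia.
move: aMv; rewrite !inE => /andP[/[dup] aM /sM/[!inE]/= /and3P[eyx yX xX] exv].
rewrite aM !negb_or /= -!andbA => /and3P[nyu yF xF].
have euy : e u y.
  have /andP[yW _] := inW _ _ eyx; apply: tour_total te _ _ _ nyu => //; first exact: sX.
  by apply: contraNneq yX => ->.
exists [:: y; x; v]; split=> //=.
by rewrite /off euy eyx exv (uR _ _ yF) (uL _ _ yF) (uL _ _ xF).
Qed.

End Tournaments.

(** * Families of arc-disjoint copies *)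

Section Copies.
Variables (VH : finType) (eH : rel VH).
Implicit Types (U : {set VH}).

(* A demand [(i, (u, v))] asks for the path of the [i]-th copy that represents the arc [(u, v)]. *)
Definition demand k U : pred (nat * (VH * VH)) :=
  fun j => [&& j.1 < k, j.2.1 \in U, j.2.2 \in U & eH j.2.1 j.2.2].

(** A single path family indexed by demands merges disjointness within a copy and between copies
    into one condition. Different copies may share branch vertices. *)
Definition copies k U (V : finType) (W : {set V}) (e : rel V)
    (phi : nat -> VH -> V) (P : nat * (VH * VH) -> seq V) : Prop :=
  [/\ forall i, i < k -> {in U &, injective (phi i)},
      forall i u, i < k -> u \in U -> phi i u \in W,
      forall j, demand k U j -> dipath e (phi j.1 j.2.1) (phi j.1 j.2.2) (P j)
    & forall j j', demand k U j -> demand k U j' -> j != j' ->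
        [disjoint path_arcs (phi j.1 j.2.1) (P j) & path_arcs (phi j'.1 j'.2.1) (P j')]].

Definition has_copies k U (V : finType) (W : {set V}) (e : rel V) : Prop :=
  exists phi P, copies k U W e phi P.

Lemma has_copies_mono k U (V : finType) (W W' : {set V}) (e e' : rel V) :
  W \subset W' -> (forall x y, e x y -> e' x y) ->
  has_copies k U W e -> has_copies k U W' e'.
Proof.
move=> /subsetP sW se [phi [P [h1 h2 h3 h4]]]; exists phi, P; split=> //.
  by move=> i u ik uU; apply/sW/h2.
by move=> j /h3[h5 h6 h7]; split=> //; apply: sub_path h5.
Qed.

Definition demands k U : seq (nat * (VH * VH)) :=
  [seq (i, a) | i <- iota 0 k, a <- enum [set a : VH * VH | [&& a.1 \in U, a.2 \in U & eH a.1 a.2]]].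

Lemma mem_demands k U j : (j \in demands k U) = demand k U j.
Proof.
apply/allpairsP/idP => [[[i a] /= [iI]]|].
  by rewrite mem_enum inE => h ->; rewrite mem_iota in iI; rewrite /demand /= h andbT.
case: j => i a /= /andP[ik h]; exists (i, a); split=> //=.
  by rewrite mem_iota.
by rewrite mem_enum inE.
Qed.

Lemma size_demands k U : size (demands k U) <= k * #|VH| ^ 2.
Proof.
rewrite size_allpairs size_iota leq_mul2l -cardE (leq_trans (max_card _)) ?orbT //.
by rewrite card_prod expnS expn1.
Qed.

(** Only arcs must be disjoint, so all copies use the same [#|U|] branch vertices in [S], and
    [route] serves at most [k * #|VH| ^ 2] demands. *)
Lemma robust_copies k U u0 (V : finType) (W : {set V}) (e : rel V) t (S : {set V}) :
  u0 \in U -> S \subset W -> #|U| <= #|S| -> 4 * (k * #|VH| ^ 2) < t ->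
  (forall u v, u \in S -> v \in S -> robust t 4 e u v) -> has_copies k U W e.
Proof.
move=> u0U /subsetP sS cS kt rob.
have /set0Pn[x0 _] : S != set0.
  by rewrite -card_gt0; apply: leq_trans cS; apply/card_gt0P; exists u0.
pose f u := nth x0 (enum S) (index u (enum U)).
have iU u : u \in U -> index u (enum U) < size (enum S).
  by move=> uU; rewrite -cardE (leq_trans _ cS) // cardE index_mem mem_enum.
have fS u : u \in U -> f u \in S by move=> /iU uU; rewrite -mem_enum mem_nth.
have [|j|P [dP disP]] := @route _ _ (fun j : nat * (VH * VH) => f j.2.1)
  (fun j => f j.2.2) e t 4 (demands k U).
- by apply: leq_ltn_trans kt; rewrite leq_mul2l size_demands orbT.
- by rewrite mem_demands => /and4P[_ uU vU _]; apply: rob; apply: fS.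
exists (fun _ => f), P; split=> [i _ u v uU vU|i u _ uU|j|j j'].
- move/eqP; rewrite nth_uniq ?iU ?enum_uniq // => /eqP.
  by apply: (index_inj u0); rewrite mem_enum.
- exact/sS/fS.
- by rewrite -mem_demands; apply: dP.
- by rewrite -!mem_demands; apply: disP.
Qed.

Lemma copies_restrict k U U' (V : finType) (W X : {set V}) (e : rel V) phi P :
  copies k U W e phi P -> U' \subset U ->
  (forall i u, i < k -> u \in U' -> phi i u \in X) ->
  (forall j, demand k U' j -> forall z, z \in phi j.1 j.2.1 :: P j -> z \in X) ->
  copies k U' X (rst X e) phi P.
Proof.
move=> [inj inW dP dis] /subsetP sU inX PX.
have dU j : demand k U' j -> demand k U j.
  by rewrite /demand => /and4P[-> /sU-> /sU-> ->].
split=> // [i ik|j dj|j j' dj dj'].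
- by move=> u v /sU uU /sU vU; apply: inj.
- by have [ps ls us] := dP _ (dU _ dj); split=> //; apply: path_rst ps (PX _ dj).
- by apply: dis; apply: dU.
Qed.

(** Copies inside disjoint vertex sets share no arc. The new copy gets index 0 and the others are
    shifted. *)
Lemma has_copies_succ k U (V : finType) (W X Y : {set V}) (e : rel V) :
  [disjoint X & Y] -> X \subset W -> Y \subset W ->
  has_copies 1 U X (rst X e) -> has_copies k U Y (rst Y e) ->
  has_copies k.+1 U W (rst W e).
Proof.
move=> dXY /subsetP sX /subsetP sY [phi [P [inj inX dP dis]]] [psi [Q [inj' inY dQ dis']]].
exists (fun i => if i is i'.+1 then psi i' else phi 0).
exists (fun j => if j.1 is i'.+1 then Q (i', j.2) else P (0, j.2)).
have dX a i : [disjoint path_arcs (phi 0 a.1) (P (0, a)) & path_arcs (psi i.1 i.2.1) (Q i)]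
  \/ ~~ (demand 1 U (0, a) && demand k U i).
  case d1: (demand 1 U _); last by right.
  case d2: (demand k U _); last by right.
  left; have [p1 _ _] := dP _ d1; have [p2 _ _] := dQ _ d2.
  apply: path_arcs_disjoint p1 p2 _ => b c /and3P[bX _ _] /and3P[bY _ _].
  by have := disjointFr dXY bX; rewrite bY.
split=> [[|i] ik u v|[|i] u ik uU|[[|i] a] dj|[[|i] a] [[|i'] a'] dj dj' nj] /=.
- exact: inj.
- exact: inj'.
- exact/sX/inX.
- exact/sY/inY.
- have [p1 l1 u1] := dP (0, a) dj; split=> //.
  by apply: sub_path p1 => x y /and3P[/sX xX /sX yX exy]; apply/and3P.
- have [p1 l1 u1] := dQ (i, a) dj; split=> //.
  by apply: sub_path p1 => x y /and3P[/sY xX /sY yX exy]; apply/and3P.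
- by apply: (dis (0, a) (0, a')).
- have d1 : demand 1 U (0, a) := dj; have d2 : demand k U (i', a') := dj'.
  by have [//|] := dX a (i', a'); rewrite d1 d2.
- have d1 : demand 1 U (0, a') := dj'; have d2 : demand k U (i, a) := dj.
  by rewrite disjoint_sym; have [//|] := dX a' (i, a); rewrite d1 d2.
- by apply: (dis' (i, a) (i', a')).
Qed.

End Copies.

(** * Degree layouts *)

Section Layouts.
Variables (V : finType).
Implicit Types (e r : rel V) (W X : {set V}) (s : seq V).

Definition before s c : {set V} := [set x in s | index x s < c].
Definition after s c : {set V} := [set x in s | c <= index x s].

Lemma card_before s c : uniq s -> #|before s c| = minn c (size s).
Proof.
move=> us; rewrite -size_take_min -(card_uniqP (take_uniq c us)) cardsE.
apply: eq_card => x; rewrite [LHS]unfold_in; have [xs|xs] := boolP (x \in s).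
  by rewrite in_take.
by symmetry; apply: contraNF xs; apply: mem_take.
Qed.

Lemma before_leq s c c' : c <= c' -> before s c \subset before s c'.
Proof.
by move=> cc; apply/subsetP=> x; rewrite !inE => /andP[-> h]; apply: leq_trans cc.
Qed.

Lemma path_closed r X x p : path r x p -> x \in X ->
  (forall a b, r a b -> a \in X -> b \in X) -> forall z, z \in x :: p -> z \in X.
Proof.
move=> rp xX cl z; elim: p x rp xX => [|y p IH] x /=; first by rewrite inE => _ xX /eqP->.
move=> /andP[rxy rp] xX; rewrite in_cons => /orP[/eqP->//|].
exact: IH rp (cl _ _ rxy xX).
Qed.

Lemma path_coclosed r X x p : path r x p -> last x p \in X ->
  (forall a b, r a b -> b \in X -> a \in X) -> forall z, z \in x :: p -> z \in X.
Proof.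
move=> rp lX cl; elim: p x rp lX => [|y p IH] x /=; first by move=> _ xX z; rewrite inE => /eqP->.
move=> /andP[rxy rp] lX z; have inX := IH _ rp lX.
by rewrite in_cons => /orP[/eqP->|/inX//]; apply: cl rxy (inX _ (mem_head _ _)).
Qed.

(** The ordering is nearly transitive: [w] is the price of deleting all back arcs over a cut, and
    [D] limits the obstacles to forward 2-paths across a gap. *)
Definition layout W e D w s : Prop :=
  [/\ uniq s, s =i W, forall c, #|back e (before s c)| <= w,
      forall v, #|[set u | e u v && (index v s < index u s)]| <= D
    & forall v, #|[set u | e v u && (index u s < index v s)]| <= D].

End Layouts.

(** * Existence of layouts, and linking of copies across a gap *)

Section Structure.
Variables (VH : finType) (eH : rel VH).
Implicit Types (U : {set VH}).
Local Notation has_copies := (has_copies eH).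

(** Sort by non-increasing out-degree. Without [k] copies no [#|VH|] vertices are robustly
    connected, so the star lemmas bound the back degrees and [matching_robust] bounds the cuts. *)
Lemma layout_exists k U u0 (V : finType) (W : {set V}) (e : rel V) t D m :
  u0 \in U -> tour W e -> 4 * (k * #|VH| ^ 2) < t ->
  4 * t + #|VH| + 1 <= D.+1 -> 2 * (D + 4 * t) + #|VH| + 1 <= m.+1 ->
  ~ has_copies k U W e -> exists s, layout W e D (2 * D * m) s.
Proof.
move=> u0U te kt tD Dm nh; have [ir inW tot] := te.
have noS : ~ exists S : {set V}, [/\ S \subset W, #|VH| <= #|S|
    & forall u v, u \in S -> v \in S -> robust t 4 e u v].
  move=> [S [sS cS rob]]; apply: nh; apply: robust_copies u0U sS _ kt rob.
  by apply: leq_trans cS; apply: max_card.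
pose le x y := outdeg e y <= outdeg e x.
have le_tr : transitive le by move=> y x z h h'; apply: leq_trans h.
pose s := sort le (enum W).
have us : uniq s by rewrite sort_uniq enum_uniq.
have sW x : (x \in s) = (x \in W) by rewrite mem_sort mem_enum.
have ss : sorted le s by apply: sort_sorted => x y; apply: leq_total.
have deg x y : x \in W -> y \in W -> index x s < index y s -> outdeg e y <= outdeg e x.
  by move=> xW yW; apply: (sorted_ltn_index le_tr ss); rewrite sW.
have sX c : before s c \subset W by apply/subsetP=> x; rewrite inE sW => /andP[].
have dOut c y : y \in W -> y \notin before s c -> #|[set x in before s c | e y x]| <= D.
  move=> yW yX; rewrite leqNgt; apply/negP=> lt; apply: noS.
  apply: (@star_out _ _ _ _ _ (before s c) y te) (leq_trans tD lt) => // x.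
  move: yX; rewrite !inE !sW yW /= -leqNgt => cy /andP[xW xc].
  by apply: deg => //; apply: leq_trans cy.
have dIn c x : x \in before s c -> #|[set y in W :\: before s c | e y x]| <= D.
  move=> xX; rewrite leqNgt; apply/negP=> lt; apply: noS.
  apply: (@star_in _ _ _ _ _ (W :\: before s c) x te) (leq_trans tD lt).
    exact: subsetDl.
  move=> y; move: xX; rewrite !inE !sW => /andP[xW xc] /andP[h yW].
  move: h; rewrite yW /= -leqNgt => cy.
  by apply: deg => //; apply: leq_trans cy.
exists s; split=> // [c|v|v].
- rewrite leqNgt; apply/negP=> lt; apply: noS.
  have [||M [sM cM i1 i2]] := matching_exists _ _ lt.
  + move=> y; have [yX|yX] := boolP (y \in before s c).
      rewrite (_ : [set x | _] = set0) ?cards0 //.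
      by apply/setP=> x; rewrite !inE /=; move: yX; rewrite inE => ->; rewrite andbF.
    have [yW|yW] := boolP (y \in W).
      apply: leq_trans (dOut _ _ yW yX); apply: subset_leq_card; apply/subsetP=> x.
      by rewrite [in X in X -> _]inE [in X in X -> _]inE /= => /and3P[eyx _ xX]; rewrite inE xX.
    rewrite (_ : [set x | _] = set0) ?cards0 //.
    apply/setP=> x; rewrite !inE /=; apply/negbTE; apply: contra yW => /and3P[/inW/andP[]//].
  + move=> x; have [xX|xX] := boolP (x \in before s c).
      apply: leq_trans (dIn _ _ xX); apply: subset_leq_card; apply/subsetP=> y.
      rewrite [in X in X -> _]inE [in X in X -> _]inE /= => /and3P[eyx yX _].
      by rewrite in_set in_setD yX eyx; have /andP[-> _] := inW _ _ eyx.
    rewrite (_ : [set y | _] = set0) ?cards0 //.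
    by apply/setP=> y; rewrite in_set in_set /= (negbTE xX) !andbF in_set0.
  apply: (@matching_robust _ _ _ _ _ D (before s c) M te) => //; last by rewrite cM.
  move=> x xX; apply: leq_trans (dIn _ _ xX); apply: subset_leq_card; apply/subsetP=> y.
  by rewrite in_set => /andP[eyx yX]; rewrite in_set in_setD yX eyx; have /andP[-> _] := inW _ _ eyx.
- have [vW|vW] := boolP (v \in W); last first.
    rewrite (_ : [set u | _] = set0) ?cards0 //; apply/setP=> u; rewrite !inE.
    by apply/negbTE; apply: contra vW => /andP[/inW/andP[]].
  (* The prefix includes [v] here; for the arcs leaving [v] it stops just before [v]. *)
  apply: leq_trans (dIn (index v s).+1 v _); last by rewrite inE sW vW /=.
  apply: subset_leq_card; apply/subsetP=> u; rewrite !inE => /andP[euv h].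
  by have /andP[-> _] := inW _ _ euv; rewrite euv negb_and -leqNgt h orbT.
- have [vW|vW] := boolP (v \in W); last first.
    rewrite (_ : [set u | _] = set0) ?cards0 //; apply/setP=> u; rewrite !inE.
    by apply/negbTE; apply: contra vW => /andP[/inW/andP[]].
  apply: leq_trans (dOut (index v s) v vW _); last by rewrite inE ltnn andbF.
  apply: subset_leq_card; apply/subsetP=> u; rewrite !inE sW => /andP[evu h].
  by have /andP[_ ->] := inW _ _ evu; rewrite evu h.
Qed.

(** Arcs from [U1] to [U2] are routed by 2-paths through the [g] vertices in between. At most [D] of
    these have a back arc to the start and at most [D] a back arc from the end, which leaves [2 * t]
    midpoints. *)
Lemma copies_link k U1 U2 (V : finType) (W : {set V}) (e : rel V) D w s t c g :
  tour W e -> layout W e D w s -> 4 * (k * #|VH| ^ 2) < t -> 2 * D + 2 * t <= g ->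
  c + g <= size s -> [disjoint U1 & U2] ->
  (forall u v, u \in U2 -> v \in U1 -> ~~ eH u v) ->
  has_copies k U1 (before s c) (rst (before s c) e) ->
  has_copies k U2 (after s (c + g)) (rst (after s (c + g)) e) ->
  has_copies k (U1 :|: U2) W e.
Proof.
move=> te [us sW _ din dout] kt Dg cg dU noback [phi [P [injP inP dP disP]]].
move=> [psi [Q [injQ inQ dQ disQ]]]; have [ir inW tot] := te.
set A := before s c in inP dP; set B := after s (c + g) in inQ dQ.
pose Z := before s (c + g) :\: A.
have cZ : #|Z| = g.
  rewrite cardsD (setIidPr (before_leq _ (leq_addr g c))) !card_before //; lia.
have AW x : x \in A -> x \in W by rewrite inE sW => /andP[].
have BW x : x \in B -> x \in W by rewrite inE sW => /andP[].
have ZW x : x \in Z -> x \in W by rewrite !inE !sW => /andP[_ /andP[]].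
have AZ x : x \in A -> x \notin Z by rewrite !inE => ->.
have BZ x : x \in B -> x \notin Z.
  by rewrite !inE => /andP[_ h]; rewrite !negb_and -!leqNgt h !orbT.
have AB x : x \in A -> x \notin B by rewrite !inE => /andP[-> /= h]; lia.
(* Links use only arcs with an end in [Z], the given copies only arcs inside [A] or inside [B]; the
   three kinds are thus disjoint. *)
pose rZ : rel V := fun x y => e x y && ((x \in Z) || (y \in Z)).
have rob x y : x \in A -> y \in B -> robust t 4 rZ x y.
  move=> xA yB; apply: (@robust_leq _ _ 2) => //.
  pose N1 := [set z | e z x && (index x s < index z s)].
  pose N2 := [set z | e y z && (index z s < index y s)].
  apply: (@robust2 _ _ _ _ _ (Z :\: (N1 :|: N2))).
    have := cardsID (N1 :|: N2) Z; have := din x; have := dout y.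
    have := (leq_card_setU N1 N2).1; have := subset_leq_card (subsetIr Z (N1 :|: N2)).
    by rewrite -/N1 -/N2 cZ; lia.
  move=> z; rewrite in_setD in_setU negb_or -andbA => /and3P[n1 n2 zZ].
  have zs : c <= index z s < c + g.
    by move: zZ; rewrite !inE => /andP[h /andP[zs h']]; move: h; rewrite zs h' -leqNgt => ->.
  have xs : index x s < c by move: xA; rewrite inE => /andP[].
  have ys : c + g <= index y s by move: yB; rewrite inE => /andP[].
  rewrite /rZ zZ orbT !andbT; apply/andP; split.
    apply: (tour_total te) (ZW _ zZ) (AW _ xA) _ _.
      by apply: contraTneq xs => <-; lia.
    by move: n1; rewrite inE negb_and => /orP[//|]; lia.
  apply: (tour_total te) (BW _ yB) (ZW _ zZ) _ _.
    by apply: contraTneq ys => ->; lia.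
  by move: n2; rewrite inE negb_and => /orP[//|]; lia.
pose js := [seq j <- demands eH k setT | (j.2.1 \in U1) && (j.2.2 \in U2)].
have [||L [dL disL]] := @route _ _ (fun j : nat * (VH * VH) => phi j.1 j.2.1)
  (fun j => psi j.1 j.2.2) rZ t 4 js.
- apply: leq_ltn_trans kt; rewrite leq_mul2l size_filter.
  by rewrite (leq_trans (count_size _ _)) ?size_demands ?orbT.
- move=> j; rewrite mem_filter mem_demands => /and3P[/andP[uU vU] jk _].
  by apply: rob; [apply: inP | apply: inQ].
pose f i u := if u \in U1 then phi i u else psi i u.
pose R (j : nat * (VH * VH)) :=
  if j.2.1 \in U1 then if j.2.2 \in U1 then P j else L j else Q j.
have U2N u : u \in U2 -> (u \in U1) = false by move=> h; rewrite (disjointFl dU).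
have fE1 i u : u \in U1 -> f i u = phi i u by rewrite /f => ->.
have fE2 i u : u \in U2 -> f i u = psi i u by rewrite /f => /U2N->.
have kinds j : demand eH k (U1 :|: U2) j ->
  [\/ [/\ demand eH k U1 j, j.2.1 \in U1 & j.2.2 \in U1],
      [/\ j \in js, j.2.1 \in U1 & j.2.2 \in U2] |
      [/\ demand eH k U2 j, j.2.1 \in U2 & j.2.2 \in U2]].
  rewrite /demand !in_setU => /and4P[jk uU vU ej].
  case/orP: uU => uU; case/orP: vU => vU.
  - by constructor 1; rewrite jk uU vU.
  - by constructor 2; rewrite mem_filter mem_demands /demand !in_setT uU vU jk ej.
  - by have := noback _ _ uU vU; rewrite ej.
  - by constructor 3; rewrite jk uU vU.
pose rA := rst A e; pose rB := rst B e.
have key j : demand eH k (U1 :|: U2) j ->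
  [\/ [/\ demand eH k U1 j, f j.1 j.2.1 = phi j.1 j.2.1, f j.1 j.2.2 = phi j.1 j.2.2,
          R j = P j & dipath rA (f j.1 j.2.1) (f j.1 j.2.2) (R j)],
      [/\ j \in js, f j.1 j.2.1 = phi j.1 j.2.1, f j.1 j.2.2 = psi j.1 j.2.2,
          R j = L j & dipath rZ (f j.1 j.2.1) (f j.1 j.2.2) (R j)] |
      [/\ demand eH k U2 j, f j.1 j.2.1 = psi j.1 j.2.1, f j.1 j.2.2 = psi j.1 j.2.2,
          R j = Q j & dipath rB (f j.1 j.2.1) (f j.1 j.2.2) (R j)]].
  case/kinds=> [[dj uU vU]|[dj uU vU]|[dj uU vU]].
  - by constructor 1; rewrite /R uU vU !fE1 //; split=> //; apply: dP.
  - by constructor 2; rewrite /R uU (U2N _ vU) fE1 // fE2 //; split=> //; apply: dL.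
  - by constructor 3; rewrite /R (U2N _ uU) !fE2 //; split=> //; apply: dQ.
have AZd a b : rA a b -> rZ a b -> False.
  by move=> /and3P[/AZ/negbTE aZ /AZ/negbTE bZ _] /andP[_]; rewrite aZ bZ.
have BZd a b : rB a b -> rZ a b -> False.
  by move=> /and3P[/BZ/negbTE aZ /BZ/negbTE bZ _] /andP[_]; rewrite aZ bZ.
have ABd a b : rA a b -> rB a b -> False.
  by move=> /and3P[/AB/negbTE aZ _ _] /and3P[]; rewrite aZ.
exists f, R; split=> [i ik u v|i u ik|j dj|j j' dj dj' nj].
- rewrite !in_setU => /orP[uU|uU] /orP[vU|vU].
  + by rewrite !fE1 //; apply: injP ik _ _ uU vU.
  + rewrite fE1 ?fE2 // => E; have := AB _ (inP i u ik uU).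
    by rewrite E inQ.
  + rewrite fE2 ?fE1 // => E; have := AB _ (inP i v ik vU).
    by rewrite -E inQ.
  + by rewrite !fE2 //; apply: injQ ik _ _ uU vU.
- rewrite in_setU => /orP[uU|uU]; first by rewrite fE1 //; apply/AW/inP.
  by rewrite fE2 //; apply/BW/inQ.
- case: (key j dj) => [[_ _ _ _]|[_ _ _ _]|[_ _ _ _]] [p1 l1 u1]; split=> //.
  + by apply: sub_path p1 => x y /and3P[].
  + by apply: sub_path p1 => x y /andP[].
  + by apply: sub_path p1 => x y /and3P[].
- have := key j' dj'; have := key j dj.
  move=> [[d1 E1 _ E1' [p1 _ _]]|[d1 E1 _ E1' [p1 _ _]]|[d1 E1 _ E1' [p1 _ _]]];
  move=> [[d2 E2 _ E2' [p2 _ _]]|[d2 E2 _ E2' [p2 _ _]]|[d2 E2 _ E2' [p2 _ _]]].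
  + by rewrite E1 E2 E1' E2'; apply: disP.
  + exact: path_arcs_disjoint p1 p2 AZd.
  + exact: path_arcs_disjoint p1 p2 ABd.
  + by rewrite disjoint_sym; apply: path_arcs_disjoint p2 p1 AZd.
  + by rewrite E1 E2 E1' E2'; apply: disL.
  + by rewrite disjoint_sym; apply: path_arcs_disjoint p2 p1 BZd.
  + by rewrite disjoint_sym; apply: path_arcs_disjoint p2 p1 ABd.
  + exact: path_arcs_disjoint p1 p2 BZd.
  + by rewrite E1 E2 E1' E2'; apply: disQ.
Qed.

End Structure.

(** * Zones and greedy packing *)

Section Packing.
Variables (VH : finType) (eH : rel VH).
Implicit Types (U : {set VH}).
Local Notation copies := (copies eH).
Local Notation has_copies := (has_copies eH).

(** Used contrapositively: a part of a copy that avoids [F] and lies in a prefix or suffix certifies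
    [k] copies of that part there. *)
Definition part_hitting k U (V : finType) (e : rel V) (s : seq V) (F : {set V * V}) : Prop :=
  forall U' c, U' \proper U -> U' != set0 -> c <= size s ->
    (has_copies k U' (before s c) (rst (before s c) e) \/
      ~ has_copies 1 U' (before s c) (rst (before s c) (off F e))) /\
    (has_copies k U' (after s c) (rst (after s c) e) \/
      ~ has_copies 1 U' (after s c) (rst (after s c) (off F e))).

Section Zones.
Variables (k : nat) (U : {set VH}) (V : finType) (W : {set V}) (e : rel V).
Variables (D w t g : nat) (s : seq V) (F0 : {set V * V}).
Hypotheses (te : tour W e) (lay : layout W e D w s) (kt : 4 * (k * #|VH| ^ 2) < t).
Hypotheses (Dg : 2 * D + 2 * t <= g) (F0P : part_hitting k U e s F0).
Hypothesis nk : ~ has_copies k U W e.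

Definition no_back (r : rel V) c := forall a b, r a b -> b \in before s c -> a \in before s c.

Lemma path_before (r : rel V) c x p : no_back r c -> path r x p -> last x p \in before s c ->
  forall z, z \in x :: p -> z \in before s c.
Proof. by move=> nb rp lp; apply: path_coclosed rp lp nb. Qed.

Lemma path_after (r : rel V) c x p : (forall a b, r a b -> e a b) -> no_back r c -> path r x p ->
  x \in after s c -> forall z, z \in x :: p -> z \in after s c.
Proof.
have [_ inW _] := te; have [_ sW _ _ _] := lay.
move=> re nb rp xA; apply: path_closed rp xA _ => a b rab; have := nb a b rab.
have /andP[aW bW] := inW _ _ (re _ _ rab).
rewrite !inE !sW aW bW /=; lia.
Qed.

(* Of the |VH|+1 blocks of [g] vertices, one avoids the branch vertices; it would split the copy. *)
Lemma half_zone (r : rel V) x phi P : (forall a b, r a b -> off F0 e a b) ->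
  copies 1 U W r phi P -> x + (#|VH|.+1) * g <= size s ->
  (forall c, x <= c <= x + (#|VH|.+1) * g -> no_back r c) ->
  (forall u, u \in U -> phi 0 u \in before s (x + (#|VH|.+1) * g)) \/
  (forall u, u \in U -> phi 0 u \in after s x).
Proof.
move=> rF cop xs nb; have [us sW _ _ _] := lay; have [inj inW' dP dis] := cop.
have re a b : r a b -> e a b by move=> /rF/andP[].
have ind u : u \in U -> phi 0 u \in s by move=> uU; rewrite sW; apply: inW'.
have g0 : 0 < g by move: kt Dg; lia.
(* Truncated subtraction sends vertices before [x] to block 0, and [inord] does the same beyond the
   last block; the pigeonhole argument tolerates this. *)
pose slot u := (index (phi 0 u) s - x) %/ g.
have [i iI] : exists i : 'I_#|VH|.+1, forall u, u \in U -> slot u != i.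
  have [i _ iN] : exists2 i, i \in [set: 'I_#|VH|.+1] & i \notin [set inord (slot u) | u in VH].
    apply/subsetPn/negP => /subset_leq_card; rewrite cardsT card_ord => h.
    by have := leq_trans h (leq_imset_card _ _); rewrite ltnn.
  exists i => u uU; apply: contraNneq iN => E; apply/imsetP; exists u => //.
  by apply: val_inj; rewrite E /= inordK.
pose c := x + i * g.
have iG : i * g + g <= #|VH|.+1 * g by rewrite addnC -mulSn leq_mul2r ltn_ord orbT.
have free u : u \in U -> phi 0 u \in before s c \/ phi 0 u \in after s (c + g).
  move=> uU; have := iI u uU; rewrite /slot !inE ind //= => sl.
  have [lt|le] := ltnP (index (phi 0 u) s) c; first by left.
  right; rewrite leqNgt; apply: contraNN sl => lt.
  have -> : index (phi 0 u) s - x = i * g + (index (phi 0 u) s - c) by move: le; rewrite /c; lia.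
  by rewrite divnMDl // divn_small ?addn0 //; move: le lt; lia.
have nbc : no_back r c by apply: nb; rewrite /c; lia.
have nbg : no_back r (c + g) by apply: nb; rewrite /c; lia.
have BA u : phi 0 u \in after s (c + g) -> (phi 0 u \in before s c) = false.
  by rewrite !inE => /andP[-> h]; lia.
(* The free block splits the branch vertices into a left and a right part. If both are nonempty,
   both are proper, [F0P] yields [k] copies of each, and [copies_link] joins them. *)
pose U1 := [set u in U | phi 0 u \in before s c]; pose U2 := U :\: U1.
have U1P u : u \in U1 -> u \in U /\ phi 0 u \in before s c.
  by rewrite in_set => /andP.
have U2P u : u \in U2 -> u \in U /\ phi 0 u \in after s (c + g).
  by rewrite in_setD in_set => /andP[h uU]; split=> //; case: (free u uU) h => // ->; rewrite uU.
have s1 : U1 \subset U by apply/subsetP=> u /U1P[].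
have s2 : U2 \subset U by apply: subsetDl.
have dsub U' j : U' \subset U -> demand eH 1 U' j -> demand eH 1 U j.
  by move=> /subsetP sU; rewrite /demand => /and4P[-> /sU-> /sU-> ->].
have [U10|U10] := eqVneq U1 set0.
  right=> u uU; case: (free u uU) => h.
    by have : u \in U1; [rewrite in_set uU | rewrite U10 inE].
  by move: h; rewrite !inE => /andP[->]; rewrite /c /=; lia.
have [U20|U20] := eqVneq U2 set0.
  left=> u uU; have /U1P[_] : u \in U1.
    by apply/negPn/negP=> h; have : u \in U2; [rewrite in_setD h | rewrite U20 inE].
  by apply: (subsetP (before_leq _ _)); rewrite /c; lia.
case: nk.
have p1 : U1 \proper U.
  rewrite properEneq s1 andbT; apply: contraNneq U20 => E.
  by rewrite /U2 E setDv.
have p2 : U2 \proper U.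
  rewrite properEneq s2 andbT; apply: contraNneq U10 => E.
  rewrite -subset0; apply/subsetP=> u uU1; have : u \in U2 by rewrite E (subsetP s1).
  by rewrite in_setD uU1.
have U12 : U = U1 :|: U2 by rewrite /U2 setDE setUIr setUCr setIT (setUidPr s1).
have disU : [disjoint U1 & U2] by rewrite -setI_eq0 /U2 setDE setIC -setIA (setIC _ U1) setICr setI0.
have j1 i0 : i0 < 1 -> i0 = 0 by case: i0.
rewrite U12; apply: (@copies_link _ eH k U1 U2 V W e D w s t c g) => //.
- by move: xs; rewrite /c; lia.
(* The path of an arc from [U2] to [U1] would cross the cut at [c] backwards. *)
- move=> u v /[dup] uU2 /U2P[uU ua] /U1P[vU vb]; apply/negP=> euv.
  have [ps ls _] := dP (0, (u, v)) ltac:(by rewrite /demand uU vU euv).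
  have := path_before nbc ps; rewrite ls => /(_ vb _ (mem_head _ _)).
  by rewrite /= BA.
- have cs : c <= size s by move: xs; rewrite /c; lia.
  case: (F0P p1 U10 cs) => [[//|no] _]; case: no.
  exists phi, P; have : copies 1 U1 (before s c) (rst (before s c) r) phi P.
    apply: (copies_restrict cop s1) => [i0 u /j1-> /U1P[]//|j dj].
    have [ps ls _] := dP _ (dsub _ _ s1 dj); apply: path_before nbc ps _; rewrite ls.
    by move: dj => /and4P[/j1-> _ /U1P[]].
  case=> h1' h2' h3' h4'; split=> // j /h3'[q1 q2 q3]; split=> //.
  by apply: sub_path q1 => a b /and3P[aA bA rab]; apply/and3P; split=> //; apply: rF.
- have cs : c + g <= size s by move: xs; rewrite /c; lia.
  case: (F0P p2 U20 cs) => [_ [//|no]]; case: no.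
  exists phi, P; have : copies 1 U2 (after s (c + g)) (rst (after s (c + g)) r) phi P.
    apply: (copies_restrict cop s2) => [i0 u /j1-> /U2P[]//|j dj].
    have [ps ls _] := dP _ (dsub _ _ s2 dj); apply: path_after re nbg ps _.
    by move: dj => /and4P[/j1-> /U2P[]].
  case=> h1' h2' h3' h4'; split=> // j /h3'[q1 q2 q3]; split=> //.
  by apply: sub_path q1 => a b /and3P[aA bA rab]; apply/and3P; split=> //; apply: rF.
Qed.

(** Its deletion clears every cut from [l] to [r] of back arcs, since each of them crosses an end of
    the interval or lies inside. Forward arcs inside are included too, so that no nonempty path
    survives within the interval. *)
Definition zone l r : {set V * V} :=
  [set a | [&& a.1 \in before s r :\: before s l & a.2 \in before s r :\: before s l]]
  :|: (back e (before s l) :|: back e (before s r)).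

Lemma card_zone l r : #|zone l r| <= (r - l) ^ 2 + 2 * w.
Proof.
have [us sW bw _ _] := lay.
rewrite (leq_trans (leq_card_setU _ _)) // leq_add //.
  set Z := _ :\: _; rewrite (_ : [set a | _] = setX Z Z); last first.
    by apply/setP=> -[a b]; rewrite in_setX in_set.
  suff h : #|Z| <= r - l by rewrite cardsX expnS expn1 leq_mul.
  have [lr|/ltnW rl] := leqP l r.
    rewrite cardsD (setIidPr (before_leq _ lr)) !card_before //; lia.
  rewrite /Z (_ : _ :\: _ = set0) ?cards0 //; apply/eqP; rewrite setD_eq0; exact: before_leq.
by rewrite (leq_trans (leq_card_setU _ _)) // mul2n -addnn leq_add.
Qed.

Lemma zone_no_back (r : rel V) l h c : (forall a b, r a b -> off (zone l h) e a b) ->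
  l <= c <= h -> no_back r c.
Proof.
have [_ sW _ _ _] := lay; have [_ inW _] := te.
move=> rz /andP[lc ch] a b /rz/andP[eab nz]; have /andP[aW bW] := inW _ _ eab.
rewrite !inE !sW aW bW /= => bc; rewrite ltnNge; apply: contra nz => ca.
rewrite !in_setU !in_set /= !sW aW bW eab /= -!leqNgt; lia.
Qed.

(** Induction on [j]: split off the shortest initial segment that contains a copy and recurse to its
    right. A hitting set returned by the recursion is completed by a zone around the cut. *)
Lemma greedy u0 v0 j c0 : u0 \in U -> v0 \in U -> eH u0 v0 -> u0 != v0 ->
  has_copies j U (after s c0) (rst (after s c0) e) \/
  exists F : {set V * V},
    #|F| <= j * ((2 * (#|VH|.+1 * g) + 1) ^ 2 + 2 * w) /\
    ~ has_copies 1 U (after s c0) (rst (after s c0) (off (F0 :|: F) e)).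
Proof.
move=> u0U v0U e0 n0; have [us sW _ _ _] := lay; have [_ inW _] := te.
set G := #|VH|.+1 * g.
elim: j c0 => [|j IH] c0.
  (* Zero copies still require functions into [V], hence a default vertex; an empty [V] holds no
     copy. *)
  have [x0 _|noV] := pickP (@predT V).
    left; exists (fun _ _ => x0), (fun _ => [::]).
    by split=> [//|//|i /and4P[//]|i i' /and4P[//]].
  right; exists set0; rewrite cards0; split=> // -[phi _].
  by have := noV (phi 0 u0).
have aW c : after s c \subset W by apply/subsetP=> x; rewrite inE sW => /andP[].
pose X c := before s c :&: after s c0.
pose Q c := has_copies 1 U (X c) (rst (X c) e).
have [[c [Qc Qmin]]|noQ] : (exists c, Q c /\ forall c', c' < c -> ~ Q c') \/ forall c, ~ Q c.
  have [[c Qc]|nQ] := classic (exists c, Q c); last by right=> c Qc; case: nQ; exists c.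
  left; elim/ltn_ind: c Qc => c IHc Qc.
  have [[c' [lt Qc']]|nQ] := classic (exists c', c' < c /\ Q c'); first exact: IHc lt Qc'.
  by exists c; split=> // c' lt Qc'; apply: nQ; exists c'.
- case: c Qc Qmin => [|c] Qc Qmin.
    case: Qc => phi [P [_ inX _ _]]; have := inX 0 u0 isT u0U.
    by rewrite inE inE ltn0 andbF.
  have [le|lt] := leqP c0 c.+1; last first.
    case: Qc => phi [P [_ inX _ _]]; have := inX 0 u0 isT u0U.
    by rewrite !inE => /andP[/andP[_ h1] /andP[_ h2]]; lia.
  have [hj|[F [cF nF]]] := IH c.+1.
    left; apply: (has_copies_succ _ _ _ Qc hj).
    - by rewrite -setI_eq0; apply/eqP/setP=> x; rewrite !inE; case: (x \in s) => //=; lia.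
    - exact: subsetIr.
    - by apply/subsetP=> x; rewrite !inE => /andP[-> h]; apply: leq_trans h.
  (* [G] positions on either side of the cut make room for the blocks of [half_zone]; the zone has
     length at most [2 * G + 1]. *)
  right; pose l := c - G; pose h := c.+1 + G.
  exists (F :|: zone l h); split.
    rewrite (leq_trans (leq_card_setU _ _)) // addnC mulSn leq_add //.
    rewrite (leq_trans (card_zone _ _)) // leq_add2r leq_sqr /l /h; lia.
  set r := off _ e; move=> [phi [P cop]].
  have rE a b : r a b -> [/\ off F0 e a b, off F e a b & off (zone l h) e a b].
    by rewrite /r /off !in_setU !negb_or => /and3P[-> -> /andP[-> ->]].
  have copW : copies 1 U W r phi P.
    case: cop => h1 h2 h3 h4; split=> // [i u ik uU|j' /h3[p1 p2 p3]].
      by apply: (subsetP (aW c0)); apply: h2.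
    by split=> //; apply: sub_path p1 => a b /and3P[].
  have rF0 a b : r a b -> off F0 e a b by case/rE.
  have re a b : r a b -> e a b by move=> /rF0/andP[].
  have nb c' : l <= c' <= h -> no_back r c' by apply: zone_no_back => a b /rE[].
  have [_ inA dP _] := cop; have [_ inW' dPW _] := copW.
  have j1 i0 : i0 < 1 -> i0 = 0 by case: i0.
  have paths0 jj z : demand eH 1 U jj -> z \in phi jj.1 jj.2.1 :: P jj -> z \in after s c0.
    move=> dj; have [p1 _ _] := dP _ dj; apply: (path_closed p1).
      by case/and4P: dj => *; apply: inA.
    by move=> a b /and3P[].
  (* Otherwise [half_zone] would put the copy inside [X c], against the minimality of [c.+1]. *)
  have lo : forall u, u \in U -> phi 0 u \in after s l.
    have [Gc|cG] := leqP G c; last first.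
      by move=> u uU; rewrite inE sW inW' //= /l; lia.
    have [sc|cs] := leqP c (size s); last first.
      have XX : X c = X c.+1.
        apply/setP=> x; rewrite !inE; have [xs|] := boolP (x \in s) => //=.
        have xc : index x s < c by apply: leq_trans (ltnW cs); rewrite index_mem.
        by rewrite xc (leq_trans xc).
      by case: (Qmin c) => //; rewrite /Q XX.
    have lG : l + G = c by rewrite /l subnK.
    have := half_zone rF0 copW (x := l); rewrite -/G lG => /(_ sc) [||//] .
      by move=> c' /andP[h1 h2]; apply: nb; rewrite h1 /h; lia.
    move=> below; case: (Qmin c) => //; exists phi, P.
    have : copies 1 U (X c) (rst (X c) r) phi P.
      apply: (copies_restrict copW (subxx _)) => [i u ik uU|jj dj z zP].
        by rewrite in_setI inA // (j1 _ ik) below.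
      rewrite in_setI (paths0 _ _ dj zP) andbT; have [p1 l1 _] := dPW _ dj.
      apply: path_before p1 _ _ zP; first by apply: nb; rewrite /l /h; lia.
      by rewrite l1; case/and4P: dj => /j1-> _ vU _; apply: below.
    case=> h1' h2' h3' h4'; split=> // jj /h3'[q1 q2 q3]; split=> //.
    by apply: sub_path q1 => a b /and3P[aA bA rab]; apply/and3P; split=> //; apply: re.
  have hi : (forall u, u \in U -> phi 0 u \in before s h) \/
            (forall u, u \in U -> phi 0 u \in after s c.+1).
    have [sh|hs] := leqP h (size s); last first.
      left=> u uU; rewrite inE; have us' : phi 0 u \in s by rewrite sW inW'.
      by rewrite us' (leq_trans _ (ltnW hs)) // index_mem.
    apply: half_zone rF0 copW sh _ => c' /andP[h1 h2]; apply: nb.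
    by rewrite /l /h -/G in h2 *; lia.
  case: hi => [hi|hi].
    (* Confined between [l] and [h], the path of [(u0, v0)] would use a deleted arc; it is nonempty
       since [u0 != v0]. *)
    have d0 : demand eH 1 U (0, (u0, v0)) by rewrite /demand u0U v0U e0.
    have [p1 l1 _] := dPW _ d0.
    have inZ z : z \in phi 0 u0 :: P (0, (u0, v0)) -> z \in before s h :\: before s l.
      move=> zP; have nbh : no_back r h by apply: nb; rewrite /l /h; lia.
      have nbl : no_back r l by apply: nb; rewrite /l /h; lia.
      have zh : z \in before s h by apply: (path_before nbh p1) zP; rewrite l1; apply: hi.
      have := path_after re nbl p1 (lo _ u0U) zP; rewrite in_setD zh !inE andbT => /andP[-> lz].
      by rewrite -leqNgt.
    have [inj _ _ _] := cop.
    case E: (P (0, (u0, v0))) p1 l1 inZ => [|y p] /=.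
      by move=> _ /(inj 0 isT _ _ u0U v0U)/eqP; rewrite (negbTE n0).
    move=> /andP[/rE[_ _ /andP[_]]] + _ _ inZ; rewrite in_setU in_set /=.
    by rewrite !inZ ?inE ?eqxx ?orbT.
  (* Here the copy lies right of the cut, against the recursive choice of [F]. *)
  case: nF; exists phi, P.
  have : copies 1 U (after s c.+1) (rst (after s c.+1) r) phi P.
    apply: (copies_restrict copW (subxx _)) => [i u ik uU|jj dj].
      by rewrite (j1 _ ik) hi.
    have [p1 l1 _] := dPW _ dj.
    apply: path_after re _ p1 _; first by apply: nb; rewrite /l /h; lia.
    by case/and4P: dj => /j1-> uU _ _; apply: hi.
  case=> h1' h2' h3' h4'; split=> // jj /h3'[q1 q2 q3]; split=> //.
  apply: sub_path q1 => a b /and3P[aA bA /rE[/andP[eab f0] /andP[_ f1] _]]; apply/and3P; split=> //.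
  by rewrite /off eab in_setU negb_or f0 f1.
- right; exists set0; rewrite cards0; split=> // -[phi [P cop]].
  case: (noQ (size s)); exists phi, P.
  have -> : X (size s) = after s c0.
    by apply/setP=> x; rewrite !inE index_mem; case: (x \in s).
  case: cop => h1 h2 h3 h4; split=> // j' /h3[p1 p2 p3]; split=> //.
  by apply: sub_path p1 => a b /and3P[aA bA /andP[eab _]]; apply/and3P.
Qed.

End Zones.
End Packing.

(** * The induction on the pattern *)

Section ErdosPosa.
Variables (VH : finType) (eH : rel VH).
Implicit Types (U : {set VH}).
Local Notation has_copies := (has_copies eH).

Definition erdos_posa c U : Prop :=
  forall k (V : finType) (W : {set V}) (e : rel V), 0 < k -> tour W e ->
    has_copies k U W e \/
    exists F : {set V * V}, #|F| <= c * k ^ 3 /\ ~ has_copies 1 U W (off F e).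

(** One set serves the whole chain: hit the largest member for which [erdos_posa] gives a hitting
    set. Smaller members are then hit by monotonicity, and larger ones have [k] copies. *)
Lemma chain_hitting c U k (V : finType) (W : {set V}) (e : rel V) (Q : nat -> {set V}) N :
  erdos_posa c U -> 0 < k -> tour W e -> (forall i, Q i \subset W) ->
  (forall i j, i <= j -> Q i \subset Q j) ->
  exists F : {set V * V}, #|F| <= c * k ^ 3 /\ forall i, i <= N ->
    has_copies k U (Q i) (rst (Q i) e) \/ ~ has_copies 1 U (Q i) (rst (Q i) (off F e)).
Proof.
move=> ep k0 te QW Qle.
have new M : has_copies k U (Q M) (rst (Q M) e) \/
    exists F : {set V * V}, #|F| <= c * k ^ 3 /\
      forall i, i <= M -> ~ has_copies 1 U (Q i) (rst (Q i) (off F e)).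
  have [|[F [cF nF]]] := ep k V (Q M) (rst (Q M) e) k0 (tour_rst (QW M) te); first by left.
  right; exists F; split=> // i iM hi; apply: nF; apply: (has_copies_mono (Qle _ _ iM) _ hi).
  move=> x y /and3P[xQ yQ /andP[exy xyF]]; rewrite /off /rst exy xyF.
  by rewrite !(subsetP (Qle _ _ iM)).
elim: N => [|N [F [cF FP]]].
  have [hM|[F [cF nF]]] := new 0.
    exists set0; rewrite cards0; split=> // i; rewrite leqn0 => /eqP->; by left.
  by exists F; split=> // i /nF; right.
have [hM|[F' [cF' nF']]] := new N.+1; last by exists F'; split=> // i /nF'; right.
exists F; split=> // i; rewrite leq_eqVlt => /orP[/eqP->|]; first by left.
exact: FP.
Qed.

Lemma part_hitting_exists c U k (V : finType) (W : {set V}) (e : rel V) (s : seq V) :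
  (forall U', U' \proper U -> erdos_posa c U') -> 0 < k -> tour W e -> s =i W ->
  exists F : {set V * V},
    #|F| <= #|{set VH}| * (2 * (c * k ^ 3)) /\ part_hitting eH k U e s F.
Proof.
move=> ep k0 te sW.
have /fin_all_exists[f fP] : forall U' : {set VH}, exists F : {set V * V},
    #|F| <= 2 * (c * k ^ 3) /\ (U' \proper U -> forall i, i <= size s ->
    (has_copies k U' (before s i) (rst (before s i) e) \/
      ~ has_copies 1 U' (before s i) (rst (before s i) (off F e))) /\
    (has_copies k U' (after s i) (rst (after s i) e) \/
      ~ has_copies 1 U' (after s i) (rst (after s i) (off F e)))).
  move=> U'; have [pU|_] := boolP (U' \proper U); last by exists set0; rewrite cards0.
  have [||F1 [c1 h1]] := chain_hitting (Q := before s) (size s) (ep _ pU) k0 te.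
  - by move=> i; apply/subsetP=> x; rewrite inE sW => /andP[].
  - by move=> i j; apply: before_leq.
  (* Reversing the index turns the suffixes into an increasing chain. *)
  have [||F2 [c2 h2]] :=
    chain_hitting (Q := fun i => after s (size s - i)) (size s) (ep _ pU) k0 te.
  - by move=> i; apply/subsetP=> x; rewrite inE sW => /andP[].
  - by move=> i j ij; apply/subsetP=> x; rewrite !inE => /andP[-> /=]; lia.
  exists (F1 :|: F2); split.
    by rewrite (leq_trans (leq_card_setU _ _)) // mul2n -addnn leq_add.
  have sub X (F F' : {set V * V}) x y : F \subset F' -> rst X (off F' e) x y -> rst X (off F e) x y.
    move=> sF /and3P[xX yX /andP[exy nF]]; rewrite /rst /off xX yX exy /=.
    by apply: contra nF; apply: (subsetP sF).
  move=> _ i is_; split.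
    have [|n] := h1 i is_; [by left | right => h; apply: n].
    by apply: (has_copies_mono (subxx _) _ h) => x y; apply: sub; apply: subsetUl.
  have := h2 (size s - i) (leq_subr _ _); rewrite subKn // => -[|n]; [by left | right => h; apply: n].
  by apply: (has_copies_mono (subxx _) _ h) => x y; apply: sub; apply: subsetUr.
exists (\bigcup_U' f U'); split.
  rewrite -sum_nat_const; elim/big_rec2: _ => [|U' n F _ h]; first by rewrite cards0.
  by rewrite (leq_trans (leq_card_setU _ _)) // leq_add //; case: (fP U').
move=> U' i pU _ is_; have [_ /(_ pU i is_)[h1 h2]] := fP U'.
have sub X x y : rst X (off (\bigcup_U' f U') e) x y -> rst X (off (f U') e) x y.
  move=> /and3P[xX yX /andP[exy nF]]; rewrite /rst /off xX yX exy /=.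
  by apply: contra nF => h; apply/bigcupP; exists U'.
split.
  case: h1 => [|n]; [by left | right => h; apply: n].
  by apply: (has_copies_mono (subxx _) _ h) => x y; apply: sub.
case: h2 => [|n]; [by left | right => h; apply: n].
by apply: (has_copies_mono (subxx _) _ h) => x y; apply: sub.
Qed.

(** The parameters [t], [D], [m], [g] are [tau], [delta], [mu], [gamma] times [k]. The first summand
    pays for [F0], the second for [k] zones of [O(k ^ 2)] arcs each. *)
Definition step_bound c :=
  let p := #|VH| in
  let tau := 4 * p ^ 2 + 1 in
  let delta := 4 * tau + p in
  let mu := 2 * (delta + 4 * tau) + p in
  let gamma := 2 * delta + 2 * tau in
  #|{set VH}| * (2 * c) + ((2 * (p.+1 * gamma) + 1) ^ 2 + 2 * (2 * delta * mu)).

Lemma erdos_posa_step c U : simple_digraph eH ->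
  (forall U', U' \proper U -> erdos_posa c U') -> erdos_posa (step_bound c) U.
Proof.
move=> irH ep k V W e k0 te.
have [[u0 [v0 [u0U v0U e0]]]|noarc] :=
  classic (exists u v, [/\ u \in U, v \in U & eH u v]); last first.
  (* Without arcs, one injection of [U] into [W] repeated [k] times gives arc-disjoint copies. *)
  have nod j i : ~ demand eH j U i by move=> /and4P[_ uU vU euv]; apply: noarc; exists i.2.1, i.2.2.
  have [[phi [P [inj inW _ _]]]|n1] := classic (has_copies 1 U W e).
    left; exists (fun _ => phi 0), P; split=> [i _|i u _|j /nod|j j' /nod] //.
      exact: inj.
    exact: inW.
  right; exists set0; rewrite cards0; split=> // h; apply: n1.
  by apply: (has_copies_mono (subxx _) _ h) => x y /andP[].
have n0 : u0 != v0 by apply: contraTneq e0 => ->; apply: irH.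
have [|nk] := classic (has_copies k U W e); [by left | right].
set p := #|VH|.
pose tau := 4 * p ^ 2 + 1; pose delta := 4 * tau + p; pose mu := 2 * (delta + 4 * tau) + p.
pose gamma := 2 * delta + 2 * tau.
have kt : 4 * (k * p ^ 2) < tau * k by rewrite /tau; lia.
have [||s lay] := layout_exists u0U te kt (_ : _ <= (delta * k).+1) (_ : _ <= (mu * k).+1) nk.
- by rewrite -/p /delta; nia.
- by rewrite -/p /mu; nia.
have [us sW _ _ _] := lay.
have [F0 [cF0 F0P]] := part_hitting_exists ep k0 te sW.
have Dg : 2 * (delta * k) + 2 * (tau * k) <= gamma * k by rewrite /gamma; lia.
have aW : after s 0 = W by apply/setP=> x; rewrite inE sW andbT.
have [h|[F [cF nF]]] := greedy te lay kt Dg F0P nk k 0 u0U v0U e0 n0.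
  by case: nk; apply: (has_copies_mono _ _ h) => [|x y /and3P[]//]; rewrite aW.
exists (F0 :|: F); split.
  rewrite (leq_trans (leq_card_setU _ _)) // /step_bound -/p -/tau -/delta -/mu -/gamma.
  rewrite [leqRHS]mulnDl leq_add //.
    by apply: leq_trans cF0 _; rewrite !mulnA.
  apply: leq_trans cF _; rewrite [k ^ 3]expnS [leqRHS]mulnCA leq_mul2l; apply/orP; right.
  rewrite [leqRHS]mulnDl leq_add //; first by rewrite -expnMn leq_sqr -/p; nia.
  by rewrite !expnS expn0; nia.
move=> h; apply: nF; rewrite aW; apply: (has_copies_mono (subxx _) _ h) => x y /andP[exy nxy].
by have [_ /(_ _ _ exy)/andP[xW yW] _] := te; rewrite /rst /off xW yW exy.
Qed.

(** Induction on the size of [U], with the constant chosen before [U] so that it serves all smaller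
    parts at once. *)
Lemma erdos_posa_all : simple_digraph eH -> exists c, forall U, erdos_posa c U.
Proof.
move=> irH; suff [c h] : exists c, forall U, #|U| < #|VH|.+1 -> erdos_posa c U.
  by exists c => U; apply: h; rewrite ltnS max_card.
elim: #|VH|.+1 => [|m [c IH]]; first by exists 0.
exists (step_bound c) => U Um; apply: erdos_posa_step => // U' /proper_card U'U; apply: IH.
exact: leq_trans U'U Um.
Qed.

End ErdosPosa.

Theorem theorem5 (VH : finType) (eH : rel VH) :
  simple_digraph eH ->
  exists cH : nat,
    forall (k : nat), 0 < k ->
    forall (VT : finType) (eT : rel VT), tournament eT ->
      (exists C : 'I_k -> {set VT * VT},
          (forall i, immersion_copy eH eT (C i)) /\
          (forall i j, i != j -> [disjoint C i & C j]))
      \/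
      (exists F : {set VT * VT},
          [/\ F \subset arcs eT,
              #|F| <= cH * k ^ 3
            & forall A, immersion_copy eH eT A -> F :&: A != set0]).
Proof.
move=> irH; have [c ep] := erdos_posa_all irH; exists c => k k0 VT eT [irT totT].
have te : tour [set: VT] eT.
  split=> // [x y|x y _ _ /totT]; first by rewrite !inE.
  by case: (eT x y); case: (eT y x).
have [[phi [P [inj _ dP dis]]]|[F [cF nF]]] := ep setT k VT _ eT k0 te.
  have dem (i : 'I_k) u v : eH u v -> demand eH k setT (nat_of_ord i, (u, v)).
    by move=> euv; rewrite /demand !in_setT euv ltn_ord.
  left; exists (fun i : 'I_k =>
    \bigcup_(a | eH a.1 a.2) path_arcs (phi i a.1) (P (nat_of_ord i, (a.1, a.2)))).
  split=> [i|i j nij].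
    exists (phi i), (fun u v => P (nat_of_ord i, (u, v))); split=> //.
    - by move=> u v; apply: (inj i (ltn_ord i)).
    - by move=> u v /(dem i); apply: dP.
    - by move=> u v u' v' /(dem i) d1 /(dem i) d2 n; apply: (dis _ _ d1 d2); rewrite xpair_eqE eqxx.
  apply/pred0P=> b /=; apply/negbTE/negP => /andP[/bigcupP[a ea ba] /bigcupP[a' ea' ba']].
  have n : (nat_of_ord i, (a.1, a.2)) != (nat_of_ord j, (a'.1, a'.2))
    by rewrite xpair_eqE negb_and; apply/orP; left.
  by have := disjointFr (dis _ _ (dem i _ _ ea) (dem j _ _ ea') n) ba; rewrite ba'.
(* Pairs of [F] that are not arcs are dropped. *)
right; exists (F :&: arcs eT); split; first exact: subsetIr.
  exact: leq_trans (subset_leq_card (subsetIl _ _)) cF.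
move=> A [phi [P [inj dP dis ->]]]; apply/negP => /eqP F0; apply: nF.
(* A copy missed by [F] would survive in [off F eT]. *)
have offP u v : eH u v -> path (off F eT) (phi u) (P u v).
  move=> euv; have [ps _ _] := dP _ _ euv; apply: (path_off ps).
  apply/setP=> a; rewrite in_setI in_set0; apply/negbTE/negP => /andP[aF ap].
  move/setP: F0 => /(_ a); rewrite !in_setI aF in_set0 /= in_set (path_arcs_rel ps ap) /=.
  by move/negbT/negP; apply; apply/bigcupP; exists (u, v).
exists (fun _ => phi), (fun j => P j.2.1 j.2.2); split=> [i _ u v _ _|i u _ _|j|j j'].
- exact: inj.
- by rewrite inE.
- by case/and4P=> _ _ _ ej; have [_ l u] := dP _ _ ej; split=> //; apply: offP.
case: j j' => [[|//] [u v]] [[|//] [u' v']] /and4P[_ _ _ e1] /and4P[_ _ _ e2] n.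
by apply: dis.
Qed.
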